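(* Let $F:\mathbb{R}^2\to\mathbb{R}^2$ be a polynomial map whose group of linear symmetries is a compact Lie group $\Gamma$. If $F$ has a non-trivial symmetry group $\Gamma$ different from $\mathbb{Z}_2$, then there exists a point in $\mathbb{R}^2$ where the Jacobian of $F$ has an eigenvalue outside the unit disk.
   Context: Polynomial map: both coordinate functions are real polynomials in $(x,y)$. The compact Lie group $\Gamma$, acting linearly on $\mathbb{R}^2$, is the symmetry group (group of linear symmetries) of $F$ if $\Gamma$ is the largest group such that $F(\gamma\cdot(x,y))=\gamma\cdot F(x,y)$ for all $(x,y)\in\mathbb{R}^2$ and all $\gamma\in\Gamma$. Here $\mathbb{Z}_2$ denotes a group of order two. Eigenvalues may be complex; an eigenvalue is outside the unit disk when it does not have modulus less than one. *)

(* Defs.v *)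
From HB Require Import structures.
From mathcomp Require Import all_boot all_order all_algebra.
From mathcomp Require Import all_classical all_reals all_analysis.
From mathcomp Require Import complex.

Set Implicit Arguments.
Unset Strict Implicit.
Unset Printing Implicit Defensive.

Import Order.TTheory GRing.Theory Num.Theory.
Import numFieldNormedType.Exports.

Local Open Scope classical_set_scope.
Local Open Scope ring_scope.

(* Points of the plane are row vectors, and a matrix g acts on them by
   v |-> v *m g, the convention under which ['J F v] represents the
   differential of F and [eigenvalue] is defined. The matrix of this action in
   the column convention is the transpose of g. *)

Definition polynomial_map (R : realType) (F : 'rV[R]_2 -> 'rV[R]_2) : Prop :=
  exists P : 'I_2 -> {poly {poly R}},
    forall (v : 'rV[R]_2) (i : 'I_2), F v 0 i = (P i).[v 0 0, v 0 1].

Definition linear_group (R : realType) (G : set 'M[R]_2) : Prop :=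
  [/\ forall g, G g -> g \in unitmx,
      G 1%:M,
      forall g h, G g -> G h -> G (g *m h)
    & forall g, G g -> G (invmx g)].

Definition equivariant (R : realType) (F : 'rV[R]_2 -> 'rV[R]_2)
    (G : set 'M[R]_2) : Prop :=
  forall g, G g -> forall v, F (v *m g) = F v *m g.

(* The maximality ranges over all linear groups, not only the compact ones:
   F (x, y) = (x / 2, y / 3) commutes with every diagonal matrix, so its
   symmetry group is not compact, although {diag (+-1, +-1)} is the largest
   compact group commuting with it. *)
Definition symmetry_group (R : realType) (F : 'rV[R]_2 -> 'rV[R]_2)
    (G : set 'M[R]_2) : Prop :=
  [/\ linear_group G, equivariant F G
    & forall H, linear_group H -> equivariant F H -> H `<=` G].

Definition complex_eigenvalue (R : realType) (A : 'M[R]_2) (z : R[i]) : Prop :=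
  eigenvalue (map_mx (real_complex R) A) z.

(* Main.v *)
Require Import Defs.
From HB Require Import structures.
From mathcomp Require Import all_boot all_order all_algebra.
From mathcomp Require Import all_classical all_reals all_analysis.
From mathcomp Require Import complex.
From mathcomp Require Import ring lra zify.

Set Implicit Arguments.
Unset Strict Implicit.
Unset Printing Implicit Defensive.

Import Order.TTheory GRing.Theory Num.Theory.
Import numFieldNormedType.Exports.

Local Open Scope classical_set_scope.
Local Open Scope ring_scope.

(** If every eigenvalue of every Jacobian matrix of [F] has modulus less than 1,
then the trace and the determinant of the Jacobian matrix are bounded
polynomials, hence constants. So when [F] has degree [n >= 2], its top
homogeneous part [F_n] has a Jacobian matrix of zero trace and determinant.
Restricted to the line [x = 1], this says that the two components have zero
Wronskian and satisfy a first-order linear equation, which forces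
[F_n (v) = c l(v)^n w] for a nonzero vector [w] and the linear form
[l(v) = det (v, w)], up to sign. Equivariance of [F_n] then gives, for every
[g] in the group, a real [mu] with [w g = mu^n w] and [det g = mu^(n+1)]. As
the group is bounded, [mu = 1] or [mu = -1] and, unipotent elements being
trivial, [g] is determined by [mu]: the group has at most two elements. The same
argument with [w = F(0)] and [n = 0] settles affine maps that do not fix the
origin. A linear map commutes with all nonzero scalars, which are unbounded. *)

(** * Polynomials with zero Wronskian *)

Lemma coefM_top (R : nzRingType) (p q : {poly R}) (m k : nat) :
  (size p <= m.+1)%N -> (size q <= k.+1)%N ->
  (p * q)`_(m + k) = p`_m * q`_k.
Proof.
move=> sp sq; rewrite coefM.
have ltm : (m < (m + k).+1)%N by rewrite ltnS leq_addr.
rewrite (bigD1 (Ordinal ltm)) //= addKn big1 ?addr0 // => j neq_jm.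
have [ltjm|] := ltnP j m.
  by rewrite [q`__]nth_default ?mulr0 // (leq_trans sq) //; lia.
rewrite leq_eqVlt => /orP[/eqP eqmj|ltmj].
  by case/negP: neq_jm; apply/eqP/val_inj.
by rewrite nth_default ?mul0r // (leq_trans sp).
Qed.

(** In f (X r') = (X f') r the top coefficients are deg r and deg f times the same product of
    leading coefficients, so characteristic zero gives equal degrees. *)
Lemma wronskian0_size (R : numFieldType) (f r : {poly R}) :
  f != 0 -> r != 0 -> f * r^`() = f^`() * r -> size f = size r.
Proof.
move=> f0 r0 W.
have sM (p : {poly R}) : p != 0 -> size p = (size p).-1.+1.
  by move=> p0; rewrite prednK // size_poly_gt0.
have sXd (p : {poly R}) : p != 0 -> (size ('X * p^`())%R <= (size p).-1.+1)%N.
  move=> p0; rewrite -sM // mulrC (leq_trans (size_polyMleq _ _)) //.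
  by rewrite size_polyX addn2 /= lt_size_deriv.
have cXd (p : {poly R}) :
    ('X * p^`())`_(size p).-1 = lead_coef p *+ (size p).-1.
  rewrite coefXM lead_coefE; case: eqP => [->|/eqP n0]; first by rewrite mulr0n.
  by rewrite coef_deriv prednK // lt0n.
have E : f * ('X * r^`()) = 'X * f^`() * r by rewrite mulrCA W mulrA.
move/(congr1 (fun p : {poly R} => p`_((size f).-1 + (size r).-1))) : E.
rewrite !coefM_top ?sXd -?sM // !cXd -!lead_coefE mulrnAr mulrnAl => /eqP.
rewrite -subr_eq0 -[X in X - _]mulr_natr -[X in _ - X]mulr_natr -mulrBr.
rewrite !mulf_eq0 !lead_coef_eq0.
rewrite (negPf f0) (negPf r0) /= subr_eq0 eqr_nat => /eqP e.
by rewrite [RHS]sM // e -sM.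
Qed.

(** Subtracting the multiple of f that cancels the leading term of r keeps the Wronskian zero; a
    nonzero difference would still have the size of f, yet its coefficient there vanishes. *)
Lemma wronskian0_proportional (R : numFieldType) (f r : {poly R}) :
  f != 0 -> f * r^`() = f^`() * r -> exists c, r = c *: f.
Proof.
move=> f0 W; have [->|r0] := eqVneq r 0; first by exists 0; rewrite scale0r.
have sfr := wronskian0_size f0 r0 W.
exists (lead_coef r / lead_coef f); set c := _ / _.
apply/eqP; rewrite -subr_eq0; apply/negPn/negP => d0.
have /(wronskian0_size f0 d0) sfd : f * (r - c *: f)^`() = f^`() * (r - c *: f).
  by rewrite derivB derivZ !mulrBr W -!scalerAr [f * _]mulrC.
have : lead_coef (r - c *: f) = 0.
  rewrite lead_coefE -sfd coefB coefZ {1}sfr -!lead_coefE.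
  by rewrite divfK ?subrr // lead_coef_eq0.
by move/eqP; rewrite lead_coef_eq0 (negPf d0).
Qed.

(* With [f = F1 (1, y)] and [g = F2 (1, y)] for a map [(F1, F2)] homogeneous of
   degree [n], the hypotheses say that the Jacobian matrix has zero determinant
   and zero trace, by Euler's relation [x F_x + y F_y = n F]. *)
Lemma nilpotent_form (R : numFieldType) (n : nat) (f g : {poly R}) :
  f * g^`() = f^`() * g -> f *+ n - 'X * f^`() + g^`() = 0 ->
  exists a b c : R, f = (c * a) *: (b%:P - a *: 'X) ^+ n /\
                    g = (c * b) *: (b%:P - a *: 'X) ^+ n.
Proof.
move=> W T; have [f0|f0] := eqVneq f 0.
  move: T; rewrite f0 mul0rn deriv0 mulr0 subr0 add0r => g'0.
  exists 0, 1, g`_0; rewrite mulr0 !scale0r subr0 expr1n mulr1; split => //.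
  apply/polyP => -[|i]; rewrite alg_polyC coefC //=.
  move/(congr1 (fun p : {poly R} => p`_i)): g'0.
  rewrite coef_deriv coef0 => /eqP; rewrite -mulr_natr mulf_eq0 pnatr_eq0 orbF.
  by move=> /eqP.
have [b gE] := wronskian0_proportional f0 W.
(* Substituting g = b f turns the trace relation into n f = (X - b) f', which (X - b)^n also
   satisfies. *)
have {}T : f *+ n = ('X - b%:P) * f^`().
  move/eqP: T; rewrite gE derivZ -mul_polyC -addrA addr_eq0 => /eqP ->.
  by ring.
set q := ('X - b%:P) ^+ n.
have q0 : q != 0 by rewrite expf_neq0 // polyXsubC_eq0.
have Tq : q *+ n = ('X - b%:P) * q^`().
  rewrite /q deriv_exp derivXsubC mul1r mulrnAr -exprS.
  by case: (n) => [|m //]; rewrite !mulr0n.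
have [|c fE] := @wronskian0_proportional _ q f q0.
  have X0 : 'X - b%:P != 0 by rewrite polyXsubC_eq0.
  by apply: (mulfI X0); rewrite mulrCA -T mulrA -Tq mulrnAl mulrnAr.
(* The sign comes from X - b = -(b - X). *)
exists 1, b, (c * (-1) ^+ n).
have qE : q = (-1) ^+ n *: (b%:P - 1 *: 'X) ^+ n.
  by rewrite -exprZn scaleN1r scale1r opprB.
by rewrite gE fE qE !scalerA !mulr1 [c * (-1) ^+ n * b]mulrC !mulrA.
Qed.

(** * Bounded polynomials are constant *)

(** If p X + c is bounded for x >= 1, so is |p(x)| <= |p(x)| x; by induction p is constant, and it
    must be zero for p X to stay bounded. *)
Lemma size_bounded_poly (R : realFieldType) (p : {poly R}) (M : R) :
  (forall x, 1 <= x -> `|p.[x]| <= M) -> (size p <= 1)%N.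
Proof.
elim/poly_ind: p M => [|p c IH] M bM; first by rewrite size_poly0.
have M0 : 0 <= M + `|c| by rewrite addr_ge0 // (le_trans _ (bM 1 (lexx _))).
have bp x : 1 <= x -> `|p.[x]| * x <= M + `|c|.
  move=> x1; have x0 : 0 <= x by rewrite (le_trans ler01).
  rewrite -[X in _ * X](ger0_norm x0) -normrM -[_ * x](addrK c).
  by rewrite (le_trans (ler_normB _ _)) // lerD2r -hornerMXaddC bM.
have /size1_polyC pE : (size p <= 1)%N.
  apply: (IH (M + `|c|)) => x x1; apply: le_trans (bp x x1).
  by rewrite ler_peMr.
rewrite {}pE in bp *; have [->|p0] := eqVneq p`_0 0.
  by rewrite mul0r add0r size_polyC leq_b1.
have np : 0 < `|p`_0| by rewrite normr_gt0.
(* At this point |p| x equals M + |c| + |p|, which exceeds the bound. *)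
have := bp (1 + (M + `|c|) / `|p`_0|); rewrite lerDl divr_ge0 // => /(_ isT).
rewrite hornerC mulrDr mulr1 mulrCA divff ?mulr1 ?gt_eqF //.
by rewrite gerDr leNgt np.
Qed.

(** * Homogeneous parts of polynomials in two variables *)

(* [ray x y T] is [T (s x, s y)] as a polynomial in [s]: its coefficient of
   index [n] is the value at [(x, y)] of the homogeneous part of degree [n] of
   [T], and [dehom n T] is that part on the line [x = 1]. *)
Definition ray (R : comNzRingType) (x y : R) (T : {poly {poly R}}) : {poly R} :=
  (map_poly (comp_poly (y *: 'X)) T).[x *: 'X].

Definition dehom (R : nzRingType) (n : nat) (T : {poly {poly R}}) : {poly R} :=
  \poly_(j < n.+1) T`_(n - j)`_j.

Section Ray.
Variable R : comNzRingType.
Implicit Types (T : {poly {poly R}}) (x y : R).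

Lemma rayB x y T T' : ray x y (T - T') = ray x y T - ray x y T'.
Proof. by rewrite /ray rmorphB hornerD hornerN. Qed.

Lemma rayM x y T T' : ray x y (T * T') = ray x y T * ray x y T'.
Proof. by rewrite /ray rmorphM hornerM. Qed.

Lemma ray_MXaddC x y T (c : {poly R}) :
  ray x y (T * 'X + c%:P) = x *: ray x y T * 'X + (c \Po (y *: 'X)).
Proof.
rewrite /ray rmorphD rmorphM /= map_polyX map_polyC hornerMXaddC /=.
by rewrite -scalerAr -scalerAl.
Qed.

Lemma horner_ray x y T s : (ray x y T).[s] = T.[s * x, s * y].
Proof.
elim/poly_ind: T => [|T c IH]; first by rewrite /ray rmorph0 !horner0.
rewrite ray_MXaddC hornerD hornerMX hornerZ IH horner_comp hornerZ hornerX.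
rewrite hornerMXaddC hornerD hornerM hornerC [y * s]mulrC.
by congr (_ + _); rewrite [RHS]mulrC [s * x]mulrC [RHS]mulrAC.
Qed.

Lemma coef_compZX (c : {poly R}) y k : (c \Po (y *: 'X))`_k = c`_k * y ^+ k.
Proof.
elim/poly_ind: c k => [|c d IH] k; first by rewrite comp_poly0 !coef0 mul0r.
rewrite comp_poly_MXaddC -scalerAr !coefD !coefC coefZ !coefMX.
case: k => [|k] /=; first by rewrite mulr0 !add0r mulr1.
by rewrite !addr0 IH exprS mulrCA.
Qed.

Lemma coef_ray x y T k :
  (ray x y T)`_k = \sum_(j < k.+1) T`_(k - j)`_j * x ^+ (k - j) * y ^+ j.
Proof.
elim/poly_ind: T k => [|T c IH] k.
  by rewrite /ray rmorph0 horner0 coef0 big1 // => j _; rewrite !coef0 !mul0r.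
rewrite ray_MXaddC coefD coefMX coefZ coef_compZX.
rewrite big_ord_recr /= subnn expr0 mulr1 coefD coefMX coefC /= add0r.
congr (_ + _); case: k => [|k] /=; first by rewrite big_ord0.
rewrite IH mulr_sumr; apply: eq_bigr => j _.
have jk : (j <= k)%N by rewrite -ltnS.
rewrite subSn // coefD coefMX coefC /= addr0 exprS.
by rewrite !mulrA [x * _]mulrC.
Qed.

Lemma horner_dehom n T y : (dehom n T).[y] = (ray 1 y T)`_n.
Proof.
rewrite horner_poly coef_ray; apply: eq_bigr => j _.
by rewrite expr1n mulr1.
Qed.

Lemma coef_dehom n T j :
  (dehom n T)`_j = if (j <= n)%N then T`_(n - j)`_j else 0.
Proof. by rewrite coef_poly ltnS. Qed.

Lemma expr_linear (a b : R) n :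
  (b%:P - a *: 'X) ^+ n
    = \poly_(j < n.+1) ((-1) ^+ j * b ^+ (n - j) * a ^+ j *+ 'C(n, j)).
Proof.
rewrite exprBn poly_def; apply: eq_bigr => j _.
rewrite -!mul_polyC polyCMn !polyCM !polyC_exp polyCN exprMn.
by rewrite -mulr_natr -[X in _ = X * _]mulr_natr; ring.
Qed.

(** The coefficients of [dehom n T] are those of the homogeneous part, which is thus recovered from
    its restriction to x = 1. *)
Lemma coef_ray_form n T (a b c x y : R) :
  dehom n T = c *: (b%:P - a *: 'X) ^+ n ->
  (ray x y T)`_n = c * (b * x - a * y) ^+ n.
Proof.
move=> TE; rewrite coef_ray exprBn mulr_sumr; apply: eq_bigr => j _.
have jn : (j <= n)%N by rewrite -ltnS.
have := coef_dehom n T j; rewrite jn => <-.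
rewrite TE coefZ expr_linear coef_poly ltnS jn !exprMn.
by rewrite -[in LHS]mulr_natr -[in RHS]mulr_natr; ring.
Qed.

(** Euler's relation in degree n + 1 on the line x = 1: the outer derivative is the one in x, and
    ['X] stands for y. *)
Lemma dehom_deriv n T :
  dehom n T^`() = dehom n.+1 T *+ n.+1 - 'X * (dehom n.+1 T)^`().
Proof.
apply/polyP => j; rewrite coefB coefMn coefXM coef_deriv !coef_dehom.
rewrite coef_deriv; case: j => [|j] /=; first by rewrite !subn0 subr0 coefMn.
rewrite coefMn !ltnS subSS; have [ltjn|] := ltnP j n.
  by rewrite ltnW //= subnSK // -mulrnBr ?subSS // ltnS ltnW.
move=> nj; have [jn|_] := leqP j n; last by rewrite !mul0rn subrr.
(* What remains is the monomial y^(n+1), whose derivative in x is zero. *)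
have -> : j = n by move: jn nj; lia.
by rewrite subrr.
Qed.

Lemma dehom_deriv_inner n T :
  dehom n (map_poly (@deriv R) T) = (dehom n.+1 T)^`().
Proof.
apply/polyP => j; rewrite coef_deriv !coef_dehom ltnS.
have [jn|] := leqP; last by rewrite mul0rn.
by rewrite (coef_map (@deriv R)) coef_deriv subSS.
Qed.
End Ray.

(** * Two by two matrices and their eigenvalues *)

Lemma ord2P (i : 'I_2) : i = 0 \/ i = 1.
Proof. by case: i => -[|[|//]] ?; [left | right]; apply: val_inj. Qed.

Lemma sum_ord2 (V : nmodType) (F : 'I_2 -> V) : \sum_i F i = F 0 + F 1.
Proof.
rewrite !big_ord_recl big_ord0 addr0.
by congr (F _ + F _); apply: val_inj.
Qed.

Lemma det_mx2 (R : comNzRingType) (A : 'M[R]_2) :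
  \det A = A 0 0 * A 1 1 - A 0 1 * A 1 0.
Proof.
rewrite (expand_det_row A ord0) !big_ord_recl big_ord0 addr0 /cofactor.
rewrite !det_mx11 !mxE /= expr0 expr1 mul1r mulN1r mulrN.
by congr (A _ _ * A _ _ - A _ _ * A _ _); apply: val_inj.
Qed.

Lemma mxtrace2 (R : nzRingType) (A : 'M[R]_2) : \tr A = A 0 0 + A 1 1.
Proof. exact: sum_ord2. Qed.

(** The characteristic polynomial splits as (X - a)(X - b); its coefficients are compared with the
    trace and the determinant. *)
Lemma eigenvalues2 (F : closedFieldType) (A : 'M[F]_2) :
  exists a b, [/\ eigenvalue A a, eigenvalue A b, \tr A = a + b
                & \det A = a * b].
Proof.
have [r rE] := closed_field_poly_normal (char_poly A).
have sz := size_char_poly A.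
have lc : lead_coef (char_poly A) = 1 by apply/eqP; exact: char_poly_monic.
have := char_poly_trace A isT; have := char_poly_det A.
rewrite sqrrN expr1n mul1r => dA tA.
move: rE sz; rewrite lc scale1r => rE; rewrite rE size_prod_XsubC => -[].
case: r rE => [|a [|b [|]]] //; rewrite !big_cons big_nil mulr1 => rE _.
exists a, b; rewrite !eigenvalue_root_char rE !rootM !root_XsubC !eqxx orbT.
split=> //.
  apply: oppr_inj; rewrite -tA rE /= mulrBl !mulrBr coefB !coefB.
  by rewrite coefXM coefX coefCM coefMC !coefX /= -polyCM coefC /=; ring.
rewrite -dA rE /= mulrBl !mulrBr coefB !coefB.
by rewrite coefXM coefX coefCM coefMC !coefX /= -polyCM coefC /=; ring.
Qed.

Lemma norm_real_complex (R : realType) (t : R) :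
  `|real_complex R t| = real_complex R `|t|.
Proof. by rewrite normc_def /= expr0n /= addr0 sqrtr_sqr. Qed.

Lemma trace_det_bound (R : realType) (A : 'M[R]_2) :
  (forall z, complex_eigenvalue A z -> `|z| < 1) ->
  `|\tr A| <= 2 /\ `|\det A| <= 1.
Proof.
move=> lt1.
have [a [b [/lt1/ltW a1 /lt1/ltW b1]]] :=
  eigenvalues2 (map_mx (real_complex R) A).
rewrite trace_map_mx det_map_mx => tA dA; split.
  rewrite -lecR -norm_real_complex tA (le_trans (ler_normD _ _)) //.
  by rewrite rmorphD /= lerD.
rewrite -lecR -norm_real_complex dA normrM /=.
by rewrite mulr_ile1.
Qed.

(** * The Jacobian matrix of a polynomial map *)

Section Jacobian.
Variable R : realType.
Implicit Types (P : {poly {poly R}}) (v : 'rV[R]_2).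

Lemma is_diff_coord v (i : 'I_2) :
  is_diff v (fun u : 'rV[R]_2 => u 0 i : R) (fun u => u 0 i).
Proof.
apply: DiffDef; first exact: differentiable_coord.
have @f : {linear 'rV[R]_2 -> R}.
  by exists (fun N : 'rV[R]_2 => N 0 i); do 2![eexists]; do ?[constructor];
     rewrite ?mxE// => ? *; rewrite ?mxE//; move=> ?; rewrite !mxE.
by rewrite (_ : (fun _ => _) = f) // diff_lin //; exact: coord_continuous.
Qed.

Lemma is_diff_poly (p : {poly R}) v :
  is_diff v (fun u : 'rV[R]_2 => p.[u 0 1] : R)
    (fun u => p^`().[v 0 1] * u 0 1).
Proof.
elim/poly_ind: p => [|p c IH].
  rewrite (_ : (fun _ => _) = cst 0).
    2: by apply/funext => u; rewrite horner0.
  rewrite (_ : (fun u : 'rV_2 => _ * _) = 0); first exact: is_diff_cst.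
  by apply/funext => u; rewrite deriv0 horner0 mul0r.
rewrite (_ : (fun _ => _) = (fun u : 'rV[R]_2 => p.[u 0 1] : R)
   * (fun u => u 0 1) + cst c); last first.
  by apply/funext => u; rewrite hornerMXaddC.
have dp := is_diffM IH (is_diff_coord v 1).
apply: is_diff_eq (is_diffD dp (is_diff_cst _ _)) _.
apply/funext => u; rewrite derivMXaddC hornerD hornerMX /=.
rewrite /= addr0.
transitivity (p.[v 0 1] * u 0 1 + v 0 1 * (p^`().[v 0 1] * u 0 1)) => //.
by ring.
Qed.

Lemma map_deriv_MXaddC P (c : {poly R}) :
  map_poly (@deriv R) (P * 'X + c%:P)
    = map_poly (@deriv R) P * 'X + c^`()%:P.
Proof.
apply/polyP => i; rewrite !(coef_map, coefD, coefMX, coefC) raddfD /=.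
by case: i => [|i]; rewrite ?coef_map ?raddf0.
Qed.

(** Induction along Horner's scheme. [map_poly (@deriv R) P] is the partial derivative in the second
    coordinate, the inner variable. *)
Lemma is_diff_poly2 P v :
  is_diff v (fun u : 'rV[R]_2 => P.[u 0 0, u 0 1] : R)
   (fun u => P^`().[v 0 0, v 0 1] * u 0 0
             + (map_poly (@deriv R) P).[v 0 0, v 0 1] * u 0 1).
Proof.
elim/poly_ind: P => [|P c IH].
  rewrite (_ : (fun _ => _) = cst 0).
    2: by apply/funext => u; rewrite !horner0.
  rewrite (_ : (fun u : 'rV_2 => _ + _) = 0); first exact: is_diff_cst.
  by apply/funext => u; rewrite deriv0 map_poly0 !horner0 !mul0r addr0.
rewrite (_ : (fun _ => _) = (fun u : 'rV[R]_2 => P.[u 0 0, u 0 1] : R)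
   * (fun u => u 0 0) + (fun u => c.[u 0 1])); last first.
  by apply/funext => u; rewrite hornerMXaddC hornerD hornerM hornerC.
have dP := is_diffM IH (is_diff_coord v 0).
apply: is_diff_eq (is_diffD dP (is_diff_poly c v)) _.
apply/funext => u.
rewrite derivMXaddC map_deriv_MXaddC hornerMXaddC !hornerD /=.
rewrite !hornerM !hornerX !hornerC.
set Px := P^`().[_, _]; set Py := (map_poly _ _).[_, _].
transitivity (P.[v 0 0, v 0 1] * u 0 0
   + v 0 0 * (Px * u 0 0 + Py * u 0 1) + c^`().[v 0 1] * u 0 1) => //.
by ring.
Qed.

Lemma jacobian_polynomial_map (F : 'rV[R]_2 -> 'rV[R]_2)
    (P : 'I_2 -> {poly {poly R}}) v :
  (forall u i, F u 0 i = (P i).[u 0 0, u 0 1]) ->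
  forall j, 'J F v 0 j = (P j)^`().[v 0 0, v 0 1] /\
            'J F v 1 j = (map_poly (@deriv R) (P j)).[v 0 0, v 0 1].
Proof.
move=> FE j.
have dF : differentiable F v.
  have -> : F = \sum_i
      (fun u : 'rV[R]_2 => (P i).[u 0 0, u 0 1] *: delta_mx 0 i).
    apply/funext => u; rewrite [F u]row_sum_delta fct_sumE.
    by apply: eq_bigr => i _; rewrite FE.
  apply: differentiable_sum => i; apply: differentiableZl.
  exact: (@ex_diff _ _ _ _ _ _ _ (is_diff_poly2 (P i) v)).
(* The chain rule reduces the differential of F to those of its coordinates. *)
have dj : 'd (fun u => F u 0 j : R) v =
    (fun u : 'rV[R]_2 => u 0 j) \o 'd F v :> ('rV[R]_2 -> R).
  have [dc cE] := is_diff_coord (F v) j.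
  by rewrite -[in RHS]cE -(diff_comp dF dc).
have : (fun u => F u 0 j : R) = fun u : 'rV[R]_2 => (P j).[u 0 0, u 0 1].
  by apply/funext => u; rewrite FE.
move=> Fj; rewrite Fj (@diff_val _ _ _ _ _ _ _ (is_diff_poly2 (P j) v)) in dj.
have JE i : 'J F v i j = 'd F v (delta_mx 0 i) 0 j.
  by rewrite -deriveE // deriveEjacobian // -rowE [RHS]mxE.
have djE u : _ = 'd F v u 0 j := congr1 (fun f => f u) dj.
by split; rewrite JE -djE /= !mxE /= ?mulr1 ?mulr0 ?addr0 ?add0r.
Qed.
End Jacobian.

(** * Bounded groups of matrices *)

Lemma archi_bounded_le0 (R : realType) (a M : R) :
  (forall k : nat, k%:R * a <= M) -> a <= 0.
Proof.
move=> aM; rewrite leNgt; apply/negP => a0.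
have M0 : 0 <= M by have := aM 0%N; rewrite mul0r.
have := archi_boundP (divr_ge0 M0 (ltW a0)).
by rewrite ltr_pdivrMr // ltNge aM.
Qed.

(** Bernoulli's inequality 1 + k (|x| - 1) <= |x|^k makes the powers grow at least linearly if |x| >
    1. *)
Lemma bounded_powers (R : realType) (x M : R) :
  (forall k : nat, `|x ^+ k| <= M) -> `|x| <= 1.
Proof.
move=> xM; rewrite -subr_le0; apply: (@archi_bounded_le0 _ _ (M - 1)) => k.
rewrite lerBrDr (le_trans _ (xM k)) // normrX.
elim: k => [|k IH]; first by rewrite mul0r add0r expr0.
rewrite exprS; apply: le_trans (ler_wpM2l (normr_ge0 x) IH).
rewrite -subr_ge0 (_ : _ - _ = k%:R * (`|x| - 1) ^+ 2); last first.
  by rewrite -[k.+1]addn1 natrD; ring.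
by rewrite mulr_ge0 ?ler0n // sqr_ge0.
Qed.

(** A case of Cayley-Hamilton: A^2 = tr(A) A - det(A). *)
Lemma mx2_nilpotent (R : comNzRingType) (A : 'M[R]_2) :
  \tr A = 0 -> \det A = 0 -> A * A = 0.
Proof.
rewrite mxtrace2 det_mx2 => /eqP; rewrite addr_eq0 => /eqP A00 dA.
apply/matrixP => i j; rewrite [LHS]mxE [RHS]mxE sum_ord2.
move: dA; rewrite A00 => dA.
by case: (ord2P i) => ->; case: (ord2P j) => ->;
  rewrite ?A00; first [ring | rewrite -[RHS]oppr0 -dA; ring].
Qed.

Section MatrixGroup.
Variables (R : realType) (G : set 'M[R]_2) (M : R).
Hypothesis Ggroup : linear_group G.
Hypothesis Gbounded : forall g, G g -> forall i j, `|g i j| <= M.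

Lemma linear_groupX (g : 'M[R]_2) k : G g -> G (g ^+ k).
Proof.
case: Ggroup => _ G1 GM _ Gg; elim: k => [|k IH]; first exact: G1.
by rewrite exprS; exact: GM.
Qed.

(** The powers of det g are determinants of elements of the group, hence bounded. *)
Lemma bounded_group_det_le1 (g : 'M[R]_2) : G g -> `|\det g| <= 1.
Proof.
move=> Gg; apply: (@bounded_powers _ _ (M * M + M * M)) => k.
have -> : \det g ^+ k = \det (g ^+ k).
  by elim: k => [|k IH]; rewrite ?det1 // !exprS det_mulmx IH.
rewrite det_mx2.
have := Gbounded (linear_groupX k Gg); set h := g ^+ k => hM.
by rewrite (le_trans (ler_normB _ _)) // !normrM lerD // ler_pM.
Qed.

Lemma bounded_group_det (g : 'M[R]_2) : G g -> `|\det g| = 1.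
Proof.
move=> Gg; have [Gunit _ _ GV] := Ggroup.
apply/eqP; rewrite eq_le bounded_group_det_le1 //=.
have := bounded_group_det_le1 (GV _ Gg); rewrite det_inv normfV.
have := Gunit _ Gg; rewrite unitmxE unitfE -normr_gt0 => dg.
by rewrite invf_le1.
Qed.

(** N = u - 1 kills w, so det N = 0, and det u = 1 + tr N + det N gives tr N = 0. Hence N^2 = 0 and
    u^k = 1 + k N, which is bounded only if N = 0. *)
Lemma bounded_group_unipotent (u : 'M[R]_2) (w : 'rV[R]_2) :
  G u -> w != 0 -> w *m u = w -> \det u = 1 -> u = 1%:M.
Proof.
move=> Gu w0 wu du.
pose N : 'M[R]_2 := u - 1; have uE : u = 1 + N by rewrite /N addrC subrK.
have dN : \det N = 0.
  by apply/eqP/det0P; exists w => //; rewrite mulmxBr wu mulmx1 subrr.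
have tN : \tr N = 0.
  by move: du dN; rewrite uE mxtrace2 !det_mx2 !mxE /= => du dN; lra.
have uX k : u ^+ k = 1 + N *+ k.
  elim: k => [|k IH]; first by rewrite expr0 addr0.
  rewrite exprS IH uE mulrDl mul1r mulrDr mulr1 mulrnAr mx2_nilpotent //.
  by rewrite mul0rn addr0 -addrA -mulrSr.
rewrite uE; suff -> : N = 0 by rewrite addr0.
apply/matrixP => i j; rewrite [RHS]mxE; apply/eqP; rewrite -normr_le0.
apply: (@archi_bounded_le0 _ _ (M + 1)) => k.
have := Gbounded (linear_groupX k Gu) i j; rewrite uX mxE mulmxnE => kM.
rewrite -[k%:R]normr_nat -normrM mulr_natl.
rewrite -[N i j *+ k](addKr ((1 : 'M[R]_2) i j)).
rewrite addrC (le_trans (ler_normB _ _)) // lerD // mxE.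
by case: (i == j); rewrite ?normr1 ?normr0.
Qed.

Lemma bounded_group_common_eigenvector (w : 'rV[R]_2) (n : nat) :
  w != 0 ->
  (forall g, G g -> exists mu, w *m g = mu ^+ n *: w /\ \det g = mu ^+ n.+1) ->
  G = [set 1%:M] \/ (G #= `I_2)%card.
Proof.
move=> w0 Gw; have [_ G1 GM _] := Ggroup.
have {}Gw g : G g -> (w *m g = w /\ \det g = 1) \/
     (w *m g = (-1) ^+ n *: w /\ \det g = (-1) ^+ n.+1).
  move=> Gg; have [mu [wg dg]] := Gw g Gg.
  (* The exponent n + 1 is positive even for n = 0. *)
  have : `|mu| == 1.
    have := bounded_group_det Gg; rewrite dg normrX => /eqP.
    by rewrite -[X in _ == X]/1 pexpr_eq1.
  rewrite eqr_norml ler01 andbT => /orP[] /eqP mE; rewrite mE in wg dg.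
    by left; rewrite wg dg !expr1n scale1r.
  by right.
have [G1E|/eqP nG1] := pselect (G = [set 1%:M]); first by left.
right.
have [g0 Gg0 g01] : exists2 g0, G g0 & g0 <> 1%:M.
  apply: contrapT => nex; case/eqP: nG1; apply/seteqP; split => g /= Gg.
    by apply: contrapT => g1; apply: nex; exists g.
  by rewrite Gg.
have neg g : G g -> g <> 1%:M ->
    w *m g = (-1) ^+ n *: w /\ \det g = (-1) ^+ n.+1.
  move=> Gg g1; have [[wg dg]|//] := Gw g Gg.
  by case: g1; exact: bounded_group_unipotent wg dg.
have [wg0 dg0] := neg g0 Gg0 g01.
(* Two non-trivial elements both have mu = -1, so their product is unipotent, hence trivial. *)
have inv g : G g -> g <> 1%:M -> g *m g0 = 1%:M.
  move=> Gg g1; have [wg dg] := neg g Gg g1.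
  apply: (@bounded_group_unipotent _ w) => //; first exact: GM.
    rewrite mulmxA wg -scalemxAl wg0 scalerA -exprMn.
    by rewrite mulrNN mulr1 expr1n scale1r.
  by rewrite det_mulmx dg dg0 -exprMn mulrNN mulr1 expr1n.
have GE : G `\ 1%:M = [set g0].
  apply/seteqP; split => [g [Gg /= g1]|_ -> //].
  (* g = g (g0 g0) = (g g0) g0 = g0. *)
  by rewrite -[g]mulmx1 -(inv g0 Gg0 g01) mulmxA (inv g) // mul1mx.
by apply/eq_cardSP; exists 1%:M => //; rewrite GE; exact: card_set1.
Qed.
End MatrixGroup.

(** * Symmetries of the map c l(v)^n w *)

Lemma mulmx_rV2 (R : pzSemiRingType) (v : 'rV[R]_2) (g : 'M[R]_2) j :
  (v *m g) 0 j = v 0 0 * g 0 j + v 0 1 * g 1 j.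
Proof. by rewrite mxE sum_ord2. Qed.

Lemma rV2P (R : Type) (u v : 'rV[R]_2) :
  u 0 0 = v 0 0 -> u 0 1 = v 0 1 -> u = v.
Proof. by move=> e0 e1; apply/rowP => i; case: (ord2P i) => ->. Qed.

Lemma equivariant_form_eigenvector (R : realFieldType) (w : 'rV[R]_2) (c : R)
    (n : nat) (g : 'M[R]_2) :
  w != 0 -> c != 0 ->
  (forall v : 'rV[R]_2,
    (c * (w 0 1 * (v *m g) 0 0 - w 0 0 * (v *m g) 0 1) ^+ n) *: w
     = ((c * (w 0 1 * v 0 0 - w 0 0 * v 0 1) ^+ n) *: w) *m g) ->
  exists mu, w *m g = mu ^+ n *: w /\ \det g = mu ^+ n.+1.
Proof.
move=> w0 c0 eqv.
have q0 : w 0 0 ^+ 2 + w 0 1 ^+ 2 != 0.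
  apply: contra w0; rewrite paddr_eq0 ?sqr_ge0 // !sqrf_eq0.
  move=> /andP[/eqP e0 /eqP e1].
  by apply/eqP/rV2P; rewrite mxE.
pose q := w 0 0 ^+ 2 + w 0 1 ^+ 2.
(* A quarter turn of w, scaled so that l(v) = 1; then mu = l(v g). *)
pose v : 'rV[R]_2 := \row_i (if i == 0 then w 0 1 / q else - w 0 0 / q).
have lv : w 0 1 * v 0 0 - w 0 0 * v 0 1 = 1.
  by rewrite !mxE /= /q; field.
pose mu := w 0 1 * (v *m g) 0 0 - w 0 0 * (v *m g) 0 1.
have wg : w *m g = mu ^+ n *: w.
  apply: (scalerI c0); have := eqv v; rewrite lv expr1n mulr1 -/mu.
  by rewrite -scalemxAl scalerA => ->.
exists mu; split=> //.
have e0 := congr1 (fun u : 'rV_2 => u 0 0) wg.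
have e1 := congr1 (fun u : 'rV_2 => u 0 1) wg.
rewrite !mulmx_rV2 !mxE in e0 e1.
(* the determinant form of [w, v] is multiplied by [\det g] *)
rewrite exprSr -[\det g]mulr1 -lv det_mx2; move: (mu ^+ n) e0 e1 => t e0 e1.
transitivity ((t * w 0 1) * (v *m g) 0 0 - (t * w 0 0) * (v *m g) 0 1).
  by rewrite -e0 -e1 !mulmx_rV2; ring.
by rewrite /mu; ring.
Qed.

(** * The top homogeneous part under bounded trace and determinant *)

Lemma horner_eq0 (R : realFieldType) (p : {poly R}) :
  (forall y, p.[y] = 0) -> p = 0.
Proof.
move=> p0; have /size1_polyC pE : (size p <= 1)%N.
  by apply: (@size_bounded_poly _ _ 0) => x _; rewrite p0 normr0.
by have := p0 0; rewrite pE hornerC => ->.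
Qed.

Lemma horner_inj (R : realFieldType) (p q : {poly R}) :
  (forall y, p.[y] = q.[y]) -> p = q.
Proof.
move=> pq; apply/eqP; rewrite -subr_eq0; apply/eqP/horner_eq0 => y.
by rewrite hornerD hornerN pq subrr.
Qed.

Lemma dehomD (R : comNzRingType) n (A B : {poly {poly R}}) :
  dehom n (A + B) = dehom n A + dehom n B.
Proof.
apply/polyP => j; rewrite coefD !coef_dehom !coefD.
by case: leqP => // _; rewrite addr0.
Qed.

Lemma dehom_eventually0 (R : comNzRingType) (T : {poly {poly R}}) :
  exists N, forall n, (N <= n)%N -> dehom n T = 0.
Proof.
(* Beyond this bound, either n - j exceeds the degree in x or j exceeds the degree in y of the
   coefficient. *)
exists (size T + \max_(i < size T) size (T`_i)%R)%N => n Nn.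
apply/polyP => j; rewrite coef_dehom coef0; case: leqP => // jn.
have [Tn|nT] := leqP (size T) (n - j).
  by rewrite (nth_default _ Tn) coef0.
rewrite [RHS]/0 nth_default //.
have := @leq_bigmax _ (fun i : 'I_(size T) => size (T`_i)%R) (Ordinal nT).
move/leq_trans; apply; move: Nn; set m := bigop.body _ _ _ => Nn; lia.
Qed.

Lemma size_ray (R : comNzRingType) (x y : R) (T : {poly {poly R}}) N :
  (forall n, (N <= n)%N -> dehom n T = 0) -> (size (ray x y T) <= N)%N.
Proof.
move=> T0; apply/leq_sizeP => n Nn.
by rewrite (@coef_ray_form _ _ _ 0 0 0) ?mul0r // T0 // scale0r.
Qed.

Lemma coef_ray_bounded (R : realFieldType) (T : {poly {poly R}}) (M : R) n :
  (forall x y, `|T.[x, y]| <= M) -> (0 < n)%N ->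
  forall y, (ray 1 y T)`_n = 0.
Proof.
move=> TM n0 y; rewrite nth_default // (leq_trans _ n0) //.
by apply: (@size_bounded_poly _ _ M) => s _; rewrite horner_ray.
Qed.

(** The trace has degree at most n and the determinant at most 2n. Both are bounded and n > 0, so
    their parts of these degrees vanish, which gives the relations of [nilpotent_form]. *)
Lemma top_form (R : realFieldType) (P Q : {poly {poly R}}) (M : R) (n : nat) :
  (0 < n)%N ->
  (forall k, (n.+1 < k)%N -> dehom k P = 0 /\ dehom k Q = 0) ->
  (forall x y, `|(P^`() + map_poly (@deriv R) Q).[x, y]| <= M) ->
  (forall x y, `|(P^`() * map_poly (@deriv R) Q
                  - Q^`() * map_poly (@deriv R) P).[x, y]| <= M) ->
  exists a b c : R, forall x y,
    (ray x y P)`_n.+1 = c * a * (b * x - a * y) ^+ n.+1 /\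
    (ray x y Q)`_n.+1 = c * b * (b * x - a * y) ^+ n.+1.
Proof.
move=> n0 top trM detM.
pose f := dehom n.+1 P; pose g := dehom n.+1 Q.
have tr0 : f *+ n.+1 - 'X * f^`() + g^`() = 0.
  rewrite -dehom_deriv -dehom_deriv_inner -dehomD; apply: horner_eq0 => y.
  by rewrite horner_dehom (coef_ray_bounded trM).
have topx T : (forall k, (n.+1 < k)%N -> dehom k T = 0) ->
    forall y, (size (ray 1 y T^`()) <= n.+1)%N.
  move=> T0 y; apply: size_ray => k nk.
  by rewrite dehom_deriv T0 // mul0rn deriv0 mulr0 subrr.
have topy T : (forall k, (n.+1 < k)%N -> dehom k T = 0) ->
    forall y, (size (ray 1 y (map_poly (@deriv R) T)) <= n.+1)%N.
  move=> T0 y; apply: size_ray => k nk.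
  by rewrite dehom_deriv_inner T0 // deriv0.
have [topP topQ] : (forall k, (n.+1 < k)%N -> dehom k P = 0) /\
                   (forall k, (n.+1 < k)%N -> dehom k Q = 0).
  by split=> k /top[].
have det0 : (f *+ n.+1 - 'X * f^`()) * g^`()
      - (g *+ n.+1 - 'X * g^`()) * f^`() = 0.
  rewrite -!dehom_deriv -!dehom_deriv_inner; apply: horner_eq0 => y.
  have := coef_ray_bounded detM (leq_trans n0 (leq_addr n n)) y.
  rewrite rayB !rayM coefB !coefM_top ?topx ?topy // => <-.
  by rewrite hornerD hornerN !hornerM !horner_dehom.
(* The products X f' g' cancel in [det0], leaving n + 1 times the Wronskian. *)
have W : f * g^`() = f^`() * g.
  have n1 : (n.+1%:R : {poly R}) != 0.
    by rewrite -polyC_natr polyC_eq0 pnatr_eq0.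
  apply: (mulfI n1); apply/eqP; rewrite -subr_eq0 -det0; apply/eqP.
  by rewrite -[f *+ _]mulr_natl -[g *+ _]mulr_natl; ring.
have [a [b [c [fE gE]]]] := nilpotent_form W tr0.
by exists a, b, c => x y; rewrite (coef_ray_form x y fE) (coef_ray_form x y gE).
Qed.

Lemma compact_bounded_entries (R : realType) (G : set 'M[R]_2) :
  compact G -> exists M, forall g, G g -> forall i j, `|g i j| <= M.
Proof.
move=> /compact_bounded[M [_ GM]]; exists (M + 1) => g Gg i j.
have := GM (M + 1); rewrite ltrDl ltr01 => /(_ isT g Gg); apply: le_trans.
rewrite [leRHS]mx_normrE.
exact: (le_bigmax _ (fun ij => `|g ij.1 ij.2|) (i, j)).
Qed.

(** * The three cases: degree at least two, affine with F(0) nonzero, linear *)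

Theorem corollary3p3 (R : realType) (F : 'rV[R]_2 -> 'rV[R]_2)
    (Gamma : set 'M[R]_2) (F_poly : polynomial_map F)
    (Gamma_sym : symmetry_group F Gamma) (Gamma_compact : compact Gamma)
    (Gamma_nontrivial : Gamma <> [set 1%:M])
    (Gamma_not_Z2 : ~ (Gamma #= `I_2)%card) :
  exists (v : 'rV[R]_2) (z : R[i]),
    complex_eigenvalue ('J F v) z /\ ~~ (`|z| < 1).
Proof.
have [Ggroup Geqv Gmax] := Gamma_sym; have [P FE] := F_poly.
apply: contrapT => no_ev.
have J_bound v : `|\tr ('J F v)| <= 2 /\ `|\det ('J F v)| <= 1.
  apply: trace_det_bound => z zv; apply: contrapT => /negP z1.
  by apply: no_ev; exists v, z.
pose pt (x y : R) : 'rV[R]_2 := \row_i (if i == 0 then x else y).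
have trM x y : `|((P 0)^`() + map_poly (@deriv R) (P 1)).[x, y]| <= 2.
  have [+ _] := J_bound (pt x y); rewrite mxtrace2.
  have [-> _] := jacobian_polynomial_map (pt x y) FE 0.
  have [_ ->] := jacobian_polynomial_map (pt x y) FE 1.
  by rewrite !mxE /= !hornerD.
(* The bound is 2 rather than 1 so that trace and determinant share one constant. *)
have detM x y : `|((P 0)^`() * map_poly (@deriv R) (P 1)
                  - (P 1)^`() * map_poly (@deriv R) (P 0)).[x, y]| <= 2.
  have [_ dM] := J_bound (pt x y).
  rewrite (le_trans _ (le_trans dM _)) ?ler1n //.
  rewrite det_mx2; have [-> ->] := jacobian_polynomial_map (pt x y) FE 0.
  have [-> ->] := jacobian_polynomial_map (pt x y) FE 1.
  by rewrite !mxE /= !hornerD !hornerN !hornerM.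
have rayE (v : 'rV[R]_2) i s : (ray (v 0 0) (v 0 1) (P i)).[s] = F (s *: v) 0 i.
  by rewrite horner_ray FE !mxE.
(* Each homogeneous part of F is equivariant: g commutes with scaling by s, so coefficients of
   powers of s can be compared. *)
have ray_eqv g (v : 'rV[R]_2) k i : Gamma g ->
    (ray ((v *m g) 0 0) ((v *m g) 0 1) (P i))`_k
     = (\row_j (ray (v 0 0) (v 0 1) (P j))`_k *m g) 0 i.
  move=> Gg; rewrite [RHS]mulmx_rV2 [X in X * _ + _]mxE [X in _ + X * _]mxE.
  rewrite -!coefMC -coefD.
  suff -> : ray ((v *m g) 0 0) ((v *m g) 0 1) (P i)
      = ray (v 0 0) (v 0 1) (P 0) * (g 0 i)%:P
        + ray (v 0 0) (v 0 1) (P 1) * (g 1 i)%:P by [].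
  apply: horner_inj => s; rewrite hornerD !hornerM !hornerC !rayE.
  by rewrite scalemxAl Geqv // mulmx_rV2.
have [M GM] : exists M : R, forall g, Gamma g -> forall i j, `|g i j| <= M.
  exact: compact_bounded_entries.
have two (w : 'rV[R]_2) n : w != 0 -> (forall g, Gamma g ->
    exists mu, w *m g = mu ^+ n *: w /\ \det g = mu ^+ n.+1) -> False.
  by move=> w0 /(bounded_group_common_eigenvector Ggroup GM w0)[].
have [[k [k2 hk]]|low] := pselect (exists k, (1 < k)%N /\
    ((dehom k (P 0) != 0) || (dehom k (P 1) != 0))).
  have [N0 N0P] := dehom_eventually0 (P 0).
  have [N1 N1P] := dehom_eventually0 (P 1).
  have exk : exists k, (1 < k)%N &&
      ((dehom k (P 0) != 0) || (dehom k (P 1) != 0)) by exists k; rewrite k2.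
  have kN j : (1 < j)%N && ((dehom j (P 0) != 0) || (dehom j (P 1) != 0)) ->
      (j <= N0 + N1)%N.
    move=> /andP[_]; rewrite leqNgt; apply: contraL => /ltnW jN.
    by rewrite N0P ?N1P ?eqxx // (leq_trans _ jN) ?leq_addl ?leq_addr.
  (* The top degree is n + 1 with n > 0. *)
  have [[//|n]] := ex_maxnP exk kN; rewrite ltnS => /andP[n0 hn] nmax.
  have top j : (n.+1 < j)%N -> dehom j (P 0) = 0 /\ dehom j (P 1) = 0.
    move=> nj; have := contra (nmax j); rewrite -ltnNge => /(_ nj).
    rewrite (leq_trans _ nj) //= negb_or !negbK.
    by move=> /andP[/eqP -> /eqP ->].
  have [a [b [c form]]] := top_form n0 top trM detM.
  pose w := pt a b.
  (* Otherwise the top part would vanish. *)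
  have [c0 w0] : c != 0 /\ w != 0.
    apply/andP; rewrite -negb_or; apply: contraL hn => cw.
    suff z y : (ray 1 y (P 0))`_n.+1 = 0 /\ (ray 1 y (P 1))`_n.+1 = 0.
      rewrite negb_or !negbK.
      by apply/andP; split; apply/eqP/horner_eq0 => y; have [? ?] := z y;
        rewrite horner_dehom.
    have [-> ->] := form 1 y; case/orP: cw => /eqP cw.
      by rewrite cw !mul0r.
    have := congr1 (fun u : 'rV_2 => u 0 0) cw.
    have := congr1 (fun u : 'rV_2 => u 0 1) cw.
    by rewrite !mxE /= => -> ->; rewrite mulr0 mul0r.
  have topE (v : 'rV[R]_2) : \row_j (ray (v 0 0) (v 0 1) (P j))`_n.+1 =
      (c * (w 0 1 * v 0 0 - w 0 0 * v 0 1) ^+ n.+1) *: w.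
    have [p0 p1] := form (v 0 0) (v 0 1).
    by apply: rV2P; rewrite !mxE /= ?p0 ?p1 mulrAC.
  apply: (two w n.+1 w0) => g Gg.
  apply: (equivariant_form_eigenvector w0 c0) => v.
  by rewrite -!topE; apply/rowP => i; rewrite mxE ray_eqv.
(* No part of degree above 1 is left, so F is affine. *)
have size2 (v : 'rV[R]_2) i : (size (ray (v 0 0) (v 0 1) (P i))%R <= 2)%N.
  apply: size_ray => k k2; apply/eqP; apply/negPn/negP => hk; apply: low.
  by exists k; split=> //; move: hk; case: (ord2P i) => -> ->; rewrite ?orbT.
have [F0|F0] := eqVneq (F 0) 0; last first.
  (* Every g fixes F(0); with n = 0 the determinant itself serves as mu. *)
  apply: (two (F 0) 0%N) => //.
  move=> g Gg; exists (\det g); rewrite expr0 scale1r expr1; split=> //.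
  by rewrite -Geqv // mul0mx.
have F_scale s v : F (s *: v) = s *: F v.
  have F_ray t i : F (t *: v) 0 i
      = (ray (v 0 0) (v 0 1) (P i))`_0 + (ray (v 0 0) (v 0 1) (P i))`_1 * t.
    rewrite -rayE (horner_coef_wide _ (size2 v i)) !big_ord_recl big_ord0.
    by rewrite addr0 expr0 mulr1.
  have p0 i : (ray (v 0 0) (v 0 1) (P i))`_0 = 0.
    by have := F_ray 0 i; rewrite scale0r F0 mxE mulr0 addr0.
  apply/rowP => i; rewrite mxE -[v in RHS]scale1r !F_ray p0 !add0r mulr1.
  by rewrite mulrC.
(* By maximality the group contains all nonzero homotheties, and the one of ratio M + 1 violates the
   bound M on entries. *)
pose H : set 'M[R]_2 := [set g | exists2 c : R, c != 0 & g = c%:M].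
have Hgroup : linear_group H.
  split=> [_ [c c0 ->]||_ _ [c c0 ->] [d d0 ->]|_ [c c0 ->]].
  - by rewrite unitmxE det_scalar unitfE expf_neq0.
  - by exists 1; rewrite ?oner_neq0.
  - by exists (c * d); rewrite ?mulf_neq0 // scalar_mxM.
  - by exists c^-1; rewrite ?invr_neq0 // invmx_scalar.
have Heqv : equivariant F H.
  by move=> _ [c c0 ->] v; rewrite !mul_mx_scalar F_scale.
have M0 : 0 <= M by have [_ G1 _ _] := Ggroup; exact: le_trans (GM _ G1 0 0).
have : Gamma (M + 1)%:M.
  by apply: (Gmax H Hgroup Heqv); exists (M + 1) => //;
    rewrite gt_eqF // ltr_wpDl.
move=> /GM/(_ 0 0); rewrite mxE mulr1n ger0_norm; last by rewrite addr_ge0.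
by rewrite gerDl leNgt ltr01.
Qed.
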